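(* Let $n\ge 2$ be an integer and let $\mathrm{Dic}_{4n}$ be the dicyclic group of order $4n$. Then: (a) $\mathrm{Dic}_{4n}$ is quasi-Leinster if and only if $n$ is odd and $2n$ is quasi-perfect; (b) $\mathrm{Dic}_{4n}$ is almost Leinster if and only if $n$ is odd and $2n$ is almost perfect; (c) $\mathrm{Dic}_{4n}$ is Leinster if and only if $n$ is odd and $2n$ is perfect.
   Context: $\mathrm{Dic}_{4n}=\langle a,x\mid a^{2n}=1,\ x^2=a^n,\ ax=xa^{-1}\rangle$ for $n\ge 2$. For a positive integer $m$ let $D(m)=\sum_{d\mid m} d$ be the sum of all positive divisors of $m$; $m$ is perfect if $D(m)=2m$, quasi-perfect if $D(m)=2m+1$, and almost perfect if $D(m)=2m-1$. For a finite group $G$ let $D(G)=\sum_{N\trianglelefteq G}|N|$, the sum of the orders of all normal subgroups of $G$ (including the trivial subgroup and $G$ itself). The group $G$ is Leinster if $D(G)=2|G|$, quasi-Leinster if $D(G)=2|G|+1$, and almost Leinster if $D(G)=2|G|-1$. *)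

(* Defs.v *)
From mathcomp Require Import all_boot all_fingroup.

Set Implicit Arguments.
Unset Strict Implicit.
Unset Printing Implicit Defensive.

Local Open Scope nat_scope.

(* Only meaningful for 0 < m: divisors 0 is [:: 1]. *)
Definition sum_divisors (m : nat) : nat := \sum_(d <- divisors m) d.

Definition perfect (m : nat) : Prop := sum_divisors m = 2 * m.
Definition quasi_perfect (m : nat) : Prop := sum_divisors m = 2 * m + 1.
(* The truncated subtraction is harmless, since 0 < m (and 0 < #|G| below). *)
Definition almost_perfect (m : nat) : Prop := sum_divisors m = 2 * m - 1.

Definition sum_normal (gT : finGroupType) (G : {group gT}) : nat :=
  \sum_(N : {group gT} | (N <| G)%g) #|N|.

Definition leinster (gT : finGroupType) (G : {group gT}) : Prop :=
  sum_normal G = 2 * #|G|.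
Definition quasi_leinster (gT : finGroupType) (G : {group gT}) : Prop :=
  sum_normal G = 2 * #|G| + 1.
Definition almost_leinster (gT : finGroupType) (G : {group gT}) : Prop :=
  sum_normal G = 2 * #|G| - 1.

(* G is the group Dic_{4n} given by its presentation. [Grp] denotes the largest
   finite quotient of the presented group; that is the presented group itself
   here, since the relations already force its order to be at most 4n. *)
Definition is_dicyclic (n : nat) (gT : finGroupType) (G : {group gT}) : Prop :=
  (G \isog Grp (a : x : a ^+ (2 * n)%N, x ^+ 2 = a ^+ n, a * x = x * a^-1))%g.

(* Main.v *)
Require Import Defs.
From mathcomp Require Import all_boot all_fingroup.
From mathcomp Require Import ssralg zmodp cyclic ring zify.

(** Put [A = <a>], of order [2n] and index 2. The subgroups of [A] are all
    normal and contribute [D(2n)] to [D(Dic_4n)]. Every [y] outside [A] inverts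
    [a] and satisfies [y^2 = a^n], so a normal subgroup [N] not contained in [A]
    contains [a^2] and [a^n]. If [n] is odd then [a] lies in [N], so [N] is the
    whole group and [D(Dic_4n) = D(2n) + 4n]. If [n] is even, the four normal
    subgroups [G], [A], [<a^2, x>], [<a^2>] already contribute [9n > 8n + 1]. *)

Set Implicit Arguments.
Unset Strict Implicit.
Unset Printing Implicit Defensive.

Section GroupFacts.

Local Open Scope group_scope.
Variable gT : finGroupType.
Implicit Types (A H : {group gT}) (a x y : gT).

(** A cyclic group has exactly one subgroup of each order dividing its own, so [N |-> #|N|] is a
    bijection onto the divisors. *)
Lemma sum_card_cyclic_subgroups A : cyclic A ->
  \sum_(N : {group gT} | N \subset A) #|N| = sum_divisors #|A|.
Proof.
move=> cycA; rewrite -(big_enum _ _ [pred N : {group gT} | N \subset A]).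
rewrite -(big_map _ xpredT id).
apply: perm_big; apply: uniq_perm => [||d]; last 1 first.
- rewrite -dvdn_divisors ?cardG_gt0 //; apply/mapP/idP => [[N] | dvd_d].
    by rewrite mem_enum => sNA ->; apply: cardSg.
  have [c defA] := cyclicP cycA.
  have dvd_dc : d %| #[c] by rewrite orderE -defA.
  have := set11 <[c ^+ (#[c] %/ d)]>%G.
  rewrite -(cycle_sub_group dvd_dc) inE -defA => /andP[sNA /eqP oN].
  by exists <[c ^+ (#[c] %/ d)]>%G; rewrite ?mem_enum.
- rewrite map_inj_in_uniq ?enum_uniq // => N1 N2.
  rewrite !mem_enum => sN1 sN2 eqN; apply/val_inj/eqP.
  by rewrite /= (eq_subG_cyclic cycA) // eqN.
- exact: divisors_uniq.
Qed.

(** Modulo [H], a power of [x] depends only on the parity of its exponent. *)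
Lemma join_cycle_square H x : x \in 'N(H) -> x ^+ 2 \in H ->
  H <*> <[x]> = H :|: x *: H.
Proof.
move=> nHx Hx2; apply/eqP; rewrite eqEsubset; apply/andP; split; last first.
  rewrite subUset joing_subl; apply/subsetP => _ /lcosetP[h Hh ->].
  rewrite groupM //; first by rewrite (subsetP (joing_subr _ _)) ?cycle_id.
  exact: (subsetP (joing_subl _ _)).
rewrite joingC norm_joinEl ?cycle_subG //.
apply/subsetP => _ /mulsgP[_ h /cycleP[k ->] Hh ->].
rewrite -(odd_double_half k) expgD -mul2n expgM.
have Hk : (x ^+ 2) ^+ k./2 * h \in H by apply: groupM => //; apply: groupX.
case: (odd k); rewrite !inE -mulgA; last by rewrite expg0 mul1g Hk.
by rewrite mem_lcoset expg1 mulKg Hk orbT.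
Qed.

Lemma card_join_cycle_square H x : x \in 'N(H) -> x ^+ 2 \in H -> x \notin H ->
  #|H <*> <[x]>| = (2 * #|H|)%N.
Proof.
move=> nHx Hx2 notHx; rewrite join_cycle_square // cardsU card_lcoset.
rewrite disjoint_setI0 ?cards0 ?subn0 ?addnn ?mul2n //.
rewrite disjoint_sym disjoint_subset; apply/subsetP => _ /lcosetP[h Hh ->].
by rewrite inE groupMr.
Qed.

(** Inversion gives [a^-1 * x = x * a]. This puts [a ^+ 2] in any normal subgroup containing [x]. *)
Lemma conjg_inverted a x : a ^ x = a^-1 -> x ^ a = x * a ^+ 2.
Proof.
by move=> ax; rewrite conjgE mulgA (conjgC a^-1) conjVg ax invgK -mulgA expgS expg1.
Qed.

End GroupFacts.

Section RegularRepresentation.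

Import GRing.Theory.
Local Open Scope ring_scope.
Variables (n : nat) (n_gt0 : (0 < n)%N).

Let T : finType := ('Z_(2 * n) * bool)%type.

(* Right multiplication by [a] and [x] on [Dic_4n], the pair [(i, e)] standing
   for the element [a^i x^e]. *)
Definition dic_mul_a (u : T) : T := (if u.2 then u.1 - 1 else u.1 + 1, u.2).
Definition dic_mul_x (u : T) : T := (if u.2 then u.1 + n%:R else u.1, ~~ u.2).

Let natr_2n : (2 * n)%:R = 0 :> 'Z_(2 * n).
Proof. by apply: pchar_Zp; lia. Qed.

Let natr_n : - n%:R = n%:R :> 'Z_(2 * n).
Proof. by apply/eqP; rewrite eq_sym -addr_eq0 -natrD addnn -mul2n natr_2n. Qed.

Lemma dic_mul_a_inj : injective dic_mul_a.
Proof.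
move=> [i e] [j f] [+ ef]; rewrite /= {e}ef.
by case: f => /addIr ->.
Qed.

Lemma dic_mul_x_inj : injective dic_mul_x.
Proof.
move=> [i e] [j f] [+ /negb_inj ef]; rewrite /= {e}ef.
by case: f => [/addIr|] ->.
Qed.

Let pa := perm dic_mul_a_inj.
Let px := perm dic_mul_x_inj.

Let paX k u : (pa ^+ k)%g u = (if u.2 then u.1 - k%:R else u.1 + k%:R, u.2).
Proof.
elim: k u => [|k IHk] [i e]; first by rewrite expg0 perm1 /= subr0 addr0 if_same.
rewrite expgSr permM IHk permE /dic_mul_a /=.
by case: e; rewrite mulrSr; congr (_, _); ring.
Qed.

(** A concrete model of the relations: it shows that the presentation does not collapse below order
    [4 * n]. *)
Lemma exists_dicyclic_group : exists (rT : finGroupType) (H : {group rT}) (a x : rT),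
  [/\ (H :=: <[a]> <*> <[x]>)%g,
      [/\ a ^+ (2 * n) = 1, x ^+ 2 = a ^+ n & a * x = x * a^-1]%g
    & 4 * n <= #|H|]%N.
Proof.
exists {perm T}, (<[pa]> <*> <[px]>)%G, pa, px; split=> //.
  split.
  - apply/permP => [[i e]]; rewrite paX perm1 /= natr_2n subr0 addr0.
    by rewrite if_same.
  - apply/permP => [[i e]]; rewrite paX expgS expg1 permM !permE /dic_mul_x /=.
    by case: e; rewrite //= natr_n.
  - apply: (mulIg pa); rewrite mulgKV; apply/permP => [[i e]].
    rewrite !permM !permE /dic_mul_x /dic_mul_a /=.
    by case: e => /=; congr (_, _); ring.
have <- : #|T| = (4 * n)%N by rewrite card_prod card_bool card_ord Zp_cast; lia.
set H := (_ <*> _)%G.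
(* [H] is transitive: the orbit of [(0, false)], the identity element, is all of [T], whence
   [#|T| <= #|H|]. *)
rewrite -(eq_card (_ : [seq (s : {perm T}) (0, false) | s in H] =i T)).
  exact: leq_image_card.
move=> [i e]; rewrite [RHS]inE; apply/imageP.
have Ha k : (pa ^+ k \in H)%g.
  by rewrite groupX // (subsetP (joing_subl _ _)) ?cycle_id.
have Hx : (px \in H)%g by rewrite (subsetP (joing_subr _ _)) ?cycle_id.
exists (pa ^+ i * px ^+ e)%g; first by apply: groupM => //; apply: groupX.
rewrite permM paX /= add0r natr_Zp; case: e; first by rewrite expg1 permE.
by rewrite expg0 perm1.
Qed.

End RegularRepresentation.

Section Dicyclic.

Local Open Scope group_scope.

Lemma dicyclic_generators n (gT : finGroupType) (G : {group gT}) :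
    0 < n -> is_dicyclic n G ->
  exists a x, [/\ G :=: <[a]> <*> <[x]>,
      [/\ x ^+ 2 = a ^+ n, a ^ x = a^-1 & x \notin <[a]>],
      #[a] = (2 * n)%N & #|G| = (4 * n)%N].
Proof.
move=> n_gt0 dicG.
have [rT [H [b [y [defH [b2n y2 by_] leH]]]]] := exists_dicyclic_group n_gt0.
(* The model satisfies the relations, so it is a homomorphic image of [G]. *)
have leG : 4 * n <= #|G|.
  apply: leq_trans leH _; apply: leq_homg; rewrite dicG.
  by apply/existsP; exists (b, y); rewrite /= -defH b2n y2 by_ !xpair_eqE !eqxx.
have /existsP[[a x] /= /eqP[defG a2n x2 ax]] := isoGrp_hom dicG.
have ajx : a ^ x = a^-1 by rewrite conjgE ax mulKg.
have nAx : x \in 'N(<[a]>) by rewrite inE -cycleJ ajx cycleV.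
have Ax2 : x ^+ 2 \in <[a]> by rewrite x2 mem_cycle.
have dvd_a : #[a] %| 2 * n by rewrite order_dvdn a2n.
have le_a : #[a] <= 2 * n by rewrite dvdn_leq // muln_gt0.
have notAx : x \notin <[a]>.
  (* Otherwise [G] would be [<[a]>], of order at most [2 * n]. *)
  apply/negP => Ax; have := leG; rewrite -defG.
  have /joing_idPl-> : <[x]> \subset <[a]> by rewrite cycle_subG.
  by rewrite -orderE; lia.
have oG : #|G| = (2 * #[a])%N by rewrite -defG card_join_cycle_square.
have oa : #[a] = (2 * n)%N by move: leG; rewrite oG; lia.
by exists a, x; split; rewrite // oG oa mulnA.
Qed.

Variables (n : nat) (gT : finGroupType) (G : {group gT}) (a x : gT).
Hypotheses (n_gt0 : 0 < n) (defG : G :=: <[a]> <*> <[x]>).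
Hypotheses (x2 : x ^+ 2 = a ^+ n) (ax : a ^ x = a^-1) (notAx : x \notin <[a]>).
Hypotheses (oa : #[a] = (2 * n)%N) (oG : #|G| = (4 * n)%N).

Let nAx : x \in 'N(<[a]>).
Proof. by rewrite inE -cycleJ ax cycleV. Qed.

Let nAG : <[a]> <| G.
Proof.
rewrite /normal defG joing_subl join_subG normG cycle_subG.
exact: nAx.
Qed.

Let sub_cycle_normal (N : {group gT}) : N \subset <[a]> -> N <| G.
Proof.
move=> sNA; apply: char_normal_trans nAG.
by rewrite sub_cyclic_char ?cycle_cyclic.
Qed.

(** Such a [y] is [x * a ^+ k]; moving [a ^+ k] past [x] inverts it, so the two powers of [a] in
    [y ^+ 2] cancel and leave [x ^+ 2]. *)
Let outside_cycle y : y \in G -> y \notin <[a]> -> a ^ y = a^-1 /\ y ^+ 2 = a ^+ n.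
Proof.
rewrite defG join_cycle_square ?x2 ?mem_cycle // inE => /orP[-> //|].
case/lcosetP=> c /cycleP[k ->] -> _; split.
  by rewrite conjgM ax conjVg conjgE -expgS expgSr mulKg.
rewrite expgS expg1 -mulgA (mulgA _ x) (conjgC _ x).
by rewrite conjXg ax expgVn mulgKV -x2 expgS expg1.
Qed.

Lemma sum_normal_dicyclic_odd : odd n -> sum_normal G = sum_divisors (2 * n) + 4 * n.
Proof.
move=> n_odd; rewrite /sum_normal (bigID (fun N : {group gT} => N \subset <[a]>)) /=.
congr (_ + _)%N.
  rewrite -oa orderE -sum_card_cyclic_subgroups ?cycle_cyclic //.
  by apply: eq_bigl => N; rewrite andb_idl //; apply: sub_cycle_normal.
rewrite (big_pred1 G) // => N /=; apply/andP/eqP => [[nNG notNA] | ->]; last first.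
  rewrite normal_refl defG; split=> //.
  by apply: contra notAx; rewrite join_subG => /andP[_]; rewrite cycle_subG.
have [y Ny notAy] := subsetPn notNA.
have [sNG nNG'] := andP nNG.
have [ay y2] := outside_cycle (subsetP sNG y Ny) notAy.
have Ga : a \in G by rewrite -cycle_subG normal_sub.
have Na2 : a ^+ 2 \in N.
  rewrite -(mulKg y (a ^+ 2)) -conjg_inverted //.
  by rewrite groupM ?groupV // memJ_norm // (subsetP nNG').
have Na : a \in N.
  have : a ^+ n \in N by rewrite -y2; apply: groupX.
  rewrite -(odd_double_half n) n_odd expgD expg1 -mul2n expgM groupMr //.
  exact: groupX.
have sAN : <[a]> \subset N by rewrite cycle_subG.
(* It remains to see that [x] is in [N]: [y] lies in the coset of [x] modulo [<[a]>], which [N]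
   contains. *)
apply/val_inj/eqP; rewrite eqEsubset sNG /= defG join_subG sAN cycle_subG /=.
have := subsetP sNG y Ny; rewrite defG join_cycle_square ?x2 ?mem_cycle // inE.
rewrite (negPf notAy) /= mem_lcoset => /(subsetP sAN).
by rewrite groupMr // groupV.
Qed.

Lemma sum_normal_dicyclic_even : ~~ odd n -> 9 * n <= sum_normal G.
Proof.
move=> n_even.
(* Evenness puts [x ^+ 2 = a ^+ n] in [<[a ^+ 2]>], so adjoining [x] only doubles the order. *)
have n_half : n = (2 * n./2)%N by rewrite mul2n even_halfK.
have oC : #|<[a ^+ 2]>| = n by rewrite -orderE orderXdiv oa ?mulKn ?dvdn_mulr.
have sCA : <[a ^+ 2]> \subset <[a]> by apply: cycleX.
have nCx : x \in 'N(<[a ^+ 2]>) by rewrite inE -cycleJ conjXg ax expgVn cycleV.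
have Cx2 : x ^+ 2 \in <[a ^+ 2]> by rewrite x2 n_half expgM mem_cycle.
have notCx : x \notin <[a ^+ 2]> by apply: contra notAx; apply: subsetP.
pose K := (<[a ^+ 2]> <*> <[x]>)%G.
have oK : #|K| = (2 * n)%N by rewrite card_join_cycle_square // oC.
have Kx : x \in K by rewrite (subsetP (joing_subr _ _)) ?cycle_id.
have xa : x ^ a = x * a ^+ 2 by apply: conjg_inverted.
have nKG : K <| G.
  apply/andP; rewrite defG; split; first by rewrite genS ?setSU.
  rewrite join_subG !cycle_subG (subsetP (normG K) x Kx) andbT inE conjYg.
  rewrite -!cycleJ xa conjXg conjgE mulKg.
  rewrite join_subG joing_subl cycle_subG groupM //.
  by rewrite (subsetP (joing_subl _ _)) ?cycle_id.
have neq_card (M N : {group gT}) : #|M| <> #|N| -> M != N.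
  by move=> neqMN; apply/eqP => eqMN; rewrite eqMN in neqMN.
(* Both have order [2 * n], so [x] must tell them apart; the other pairs differ in order. *)
have neqKA : K != <[a]>%G.
  by apply: contra notAx => /eqP eqKA; move: Kx; rewrite eqKA.
have oA : #|<[a]>%G| = (2 * n)%N by rewrite -oa.
rewrite /sum_normal (bigD1 G) //= (bigD1 <[a]>%G) /=; last first.
  by rewrite nAG neq_card // oA oG; lia.
rewrite (bigD1 K) /=; last first.
  by rewrite nKG neqKA neq_card // oK oG; lia.
rewrite (bigD1 <[a ^+ 2]>%G) /=; last first.
  by rewrite sub_cycle_normal // !neq_card //= oC ?oA ?oK ?oG; lia.
by rewrite oA oG oK oC; lia.
Qed.

End Dicyclic.

Theorem proposition6p2 (n : nat) (gT : finGroupType) (G : {group gT})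
    (n_ge2 : 2 <= n) (dicG : is_dicyclic n G) :
  [/\ quasi_leinster G <-> odd n /\ quasi_perfect (2 * n),
      almost_leinster G <-> odd n /\ almost_perfect (2 * n)
    & leinster G <-> odd n /\ perfect (2 * n)].
Proof.
have n_gt0 : 0 < n by lia.
have [a [x [defG [x2 ax notAx] oa oG]]] := dicyclic_generators n_gt0 dicG.
rewrite /quasi_leinster /almost_leinster /leinster oG.
rewrite /quasi_perfect /almost_perfect /perfect.
case: (boolP (odd n)) => [n_odd | n_even].
  rewrite (sum_normal_dicyclic_odd defG x2 ax notAx oa oG n_odd).
  by split; (split=> [sumG | [_ sumG]]; [split=> // |]; lia).
(* All three conditions would give a sum of at most [8 * n + 1], which is below [9 * n] as
   [n >= 2]. *)
have := sum_normal_dicyclic_even n_gt0 defG x2 ax notAx oa oG n_even.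
by split; (split=> [sumG | []//]; lia).
Qed.
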